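(* For the linear operators $\mathcal F:\mathbb{R}^{\mathbf V^{\mathrm{st}}}\times\mathbb{R}^{3\times\mathbf T^{\mathrm c}}\to\mathbb{R}^{\mathbf V^{\mathrm{st}}}\times(\mathbb{R}^{3\times\mathbf T^{\mathrm{st}}})^6$ and $\mathcal B:\mathbb{R}^{\mathbf V^{\mathrm{st}}}\times(\mathbb{R}^{3\times\mathbf T^{\mathrm{st}}})^6\to\mathbb{R}^{\mathbf V^{\mathrm{st}}}\times(\mathbb{R}^{3\times\mathbf T^{\mathrm{st}}})^6\times\mathbb{R}^{\mathbf V^{\mathrm{st}}}$ defined in the context, the composite operator $\mathcal F^*\mathcal B^*\mathcal B\mathcal F$ is diagonal (as a matrix in the standard coordinates).
   Context: $V$ and $T$ are the finite sets of vertices and triangles of a triangular mesh in $\mathbb{R}^3$, and $N\ge1$ is an integer. $\mathcal G^{\mathrm c}=\{0,1,\dots,N\}$, $\mathcal G^{\mathrm{st}}=\{\frac12,\frac32,\dots,N-\frac12\}$, $\mathbf V^{\mathrm{st}}=\mathcal G^{\mathrm{st}}\times V$, $\mathbf T^{\mathrm c}=\mathcal G^{\mathrm c}\times T$, $\mathbf T^{\mathrm{st}}=\mathcal G^{\mathrm{st}}\times T$, ordered lexicographically with time first. $\mathbb{R}^{3\times\mathbf T^{\mathrm c}}$ (resp. $\mathbb{R}^{3\times\mathbf T^{\mathrm{st}}}$) is the space of families of vectors in $\mathbb{R}^3$ indexed by $\mathbf T^{\mathrm c}$ (resp. $\mathbf T^{\mathrm{st}}$), identified with $\mathbb{R}^{3|\mathbf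 T^{\mathrm c}|}$ (resp. $\mathbb{R}^{3|\mathbf T^{\mathrm{st}}|}$). $\mathcal I_n$ is the $n\times n$ identity, $\bm 0_n,\bm 1_n\in\mathbb{R}^n$ are the all-zeros and all-ones column vectors, $\otimes$ is the Kronecker product, $(\cdot)^*$ is the Euclidean adjoint (transpose), $\mathrm{Diag}$ denotes a block-diagonal matrix and $(\cdot;\cdot)$ vertical stacking. $\mathcal C_-:=(\mathcal I_N\ \ \bm 0_N)$ and $\mathcal C_+:=(\bm 0_N\ \ \mathcal I_N)$ are $N\times(N+1)$ matrices, $$\widetilde{\mathcal F}:=\begin{pmatrix}\bm 1_3\otimes\mathcal C_-\otimes\mathcal I_{3|T|}\\ \bm 1_3\otimes\mathcal C_+\otimes\mathcal I_{3|T|}\end{pmatrix}:\mathbb{R}^{3\times\mathbf T^{\mathrm c}}\to(\mathbb{R}^{3\times\mathbf T^{\mathrm{st}}})^6,\qquad \mathcal F:=\mathrm{Diag}(\mathcal I_{|\mathbf V^{\mathrm{st}}|},\widetilde{\mathcal F}).$$ Thus $\mathcal F(\bm A;\bm B)=(\bm A;\bm D_1^-;\bm D_2^-;\bm D_3^-;\bm D_1^+;\bm D_2^+;\bm D_3^+)$ with $(\bm D_i^\pm)_{k,\bm f}=\bm B_{k\pm\frac12,\bm f}$ for $(k,\bm f)\in\mathbf T^{\mathrm{st}}$, $i=1,2,3$. The operator $\mathcal B$ is $\mathcal B(\bm x;\bm y):=\big(-\bm x;\tfrac{\sqrt3}{3}\bm y;\bm x\big)$ for $\bm x\in\mathbb{R}^{\mathbf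 V^{\mathrm{st}}}$, $\bm y\in(\mathbb{R}^{3\times\mathbf T^{\mathrm{st}}})^6$. *)

(* Defs.v *)
From mathcomp Require Import all_boot all_order all_algebra.
From mathcomp Require Import reals mxtens.

Set Implicit Arguments.
Unset Strict Implicit.
Unset Printing Implicit Defensive.

Import GRing.Theory Num.Theory.
Local Open Scope ring_scope.

(* Non-degeneracy, manifoldness and embeddedness are not required, so that
   every usual notion of a triangular mesh in R^3 is an instance. *)
Record mesh (R : realType) := Mesh {
  vertex : finType;
  triangle : finType;
  position : vertex -> 'rV[R]_3;
  corner : triangle -> 'I_3 -> vertex;
  corner_inj : forall f : triangle, injective (corner f)
}.

(* The centred time grid {0, ..., N} is 'I_N.+1, and the staggered grid
   {1/2, ..., N - 1/2} is 'I_N, with k : 'I_N standing for k + 1/2.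
   Vectors are columns; [mxtens_index (k, j)] is the lexicographic index, time
   first, so j ranges over 'I_#|V| (scalar fields on vertices) or over
   'I_(3 * #|T|) (vector fields on triangles). *)
Section Operators.
Variables (R : realType) (M : mesh R) (N : nat).

Definition dimVst : nat := N * #|vertex M|.
Definition dimTc : nat := N.+1 * (3 * #|triangle M|).
Definition dimTst : nat := N * (3 * #|triangle M|).

(* the six copies of R^(3 x Tst), ordered D1-, D2-, D3-, D1+, D2+, D3+ *)
Definition dimTst6 : nat := 3 * dimTst + 3 * dimTst.

Definition Cminus : 'M[R]_(N, N.+1) :=
  castmx (erefl, addn1 N) (row_mx (1%:M : 'M_N) (0 : 'cV_N)).
Definition Cplus : 'M[R]_(N, N.+1) := row_mx (0 : 'cV_N) (1%:M : 'M_N).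

(* 1_3 (x) C (x) I_(3|T|); the cast turns 1 * dimTc columns into dimTc *)
Definition stack3 (C : 'M[R]_(N, N.+1)) : 'M[R]_(3 * dimTst, dimTc) :=
  castmx (erefl, mul1n dimTc)
    (tensmx (const_mx 1 : 'cV[R]_3)
            (tensmx C (1%:M : 'M[R]_(3 * #|triangle M|)))).

Definition Ftilde : 'M[R]_(dimTst6, dimTc) :=
  col_mx (stack3 Cminus) (stack3 Cplus).

Definition opF : 'M[R]_(dimVst + dimTst6, dimVst + dimTc) :=
  block_mx 1%:M 0 0 Ftilde.

Definition opB : 'M[R]_(dimVst + (dimTst6 + dimVst), dimVst + dimTst6) :=
  col_mx (row_mx (- 1%:M) 0)
    (col_mx (row_mx 0 (Num.sqrt 3 / 3)%:M)
            (row_mx 1%:M 0)).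

Lemma opFE (A : 'cV[R]_dimVst) (B : 'cV[R]_dimTc) :
  opF *m col_mx A B =
    col_mx A (col_mx (stack3 Cminus *m B) (stack3 Cplus *m B)).
Proof.
by rewrite mul_block_col mul1mx !mul0mx addr0 add0r mul_col_mx.
Qed.

Lemma stack3E (C : 'M[R]_(N, N.+1)) (B : 'cV[R]_dimTc)
    (i : 'I_3) (k : 'I_N) (j : 'I_(3 * #|triangle M|)) :
  (stack3 C *m B) (mxtens_index (i, mxtens_index (k, j))) 0 =
    \sum_l C k l * B (mxtens_index (l, j)) 0.
Proof.
rewrite mxE (reindex (@mxtens_index N.+1 (3 * #|triangle M|))) /=; last first.
  by exists (@mxtens_unindex _ _) => x _; [exact: mxtens_indexK |
    exact: mxtens_unindexK].
rewrite (eq_bigr (fun p => C k p.1 * (j == p.2)%:R *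
    B (mxtens_index (p.1, p.2)) 0)); last first.
  move=> [l j'] _ /=; congr (_ * _).
  rewrite castmxE /= cast_ord_id.
  have -> : cast_ord (esym (mul1n dimTc)) (mxtens_index (l, j')) =
      mxtens_index (ord0 : 'I_1, mxtens_index (l, j')) by exact: val_inj.
  by rewrite !tensmxE !mxE mul1r.
rewrite -(pair_bigA _ (fun l j' => C k l * (j == j')%:R *
    B (mxtens_index (l, j')) 0)) /=.
apply: eq_bigr => l _; rewrite (bigD1 j) //= eqxx mulr1 big1 ?addr0 // => j'.
by rewrite eq_sym => /negPf ->; rewrite mulr0 mul0r.
Qed.

Lemma stack3_CminusE (B : 'cV[R]_dimTc)
    (i : 'I_3) (k : 'I_N) (j : 'I_(3 * #|triangle M|)) :
  (stack3 Cminus *m B) (mxtens_index (i, mxtens_index (k, j))) 0 =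
    B (mxtens_index (widen_ord (leqnSn N) k, j)) 0.
Proof.
rewrite stack3E (bigD1 (widen_ord (leqnSn N) k)) //= big1 => [|l neq].
  rewrite castmxE cast_ord_id /= /Cminus.
  have -> : cast_ord (esym (addn1 N)) (widen_ord (leqnSn N) k) = lshift 1 k.
    exact: val_inj.
  by rewrite row_mxEl mxE eqxx mul1r addr0.
rewrite castmxE cast_ord_id /= mxE; case: splitP => l' /= def_l; rewrite !mxE.
  case: eqP => [kl|_]; last by rewrite mul0r.
  by case/eqP: neq; apply: val_inj; rewrite /= def_l kl.
by rewrite mul0r.
Qed.

Lemma stack3_CplusE (B : 'cV[R]_dimTc)
    (i : 'I_3) (k : 'I_N) (j : 'I_(3 * #|triangle M|)) :
  (stack3 Cplus *m B) (mxtens_index (i, mxtens_index (k, j))) 0 =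
    B (mxtens_index (lift ord0 k, j)) 0.
Proof.
rewrite stack3E (bigD1 (lift ord0 k)) //= big1 => [|l neq].
  have -> : lift ord0 k = rshift 1 k by exact: val_inj.
  by rewrite /Cplus (row_mxEr (0 : 'cV_N)) mxE eqxx mul1r addr0.
rewrite mxE; case: splitP => l' /= def_l; rewrite !mxE ?mul0r //.
case: eqP => [kl|_]; last by rewrite mul0r.
by case/eqP: neq; apply: val_inj; rewrite /= def_l kl.
Qed.

Lemma opBE (x : 'cV[R]_dimVst) (y : 'cV[R]_dimTst6) :
  opB *m col_mx x y =
    col_mx (- x) (col_mx ((Num.sqrt 3 / 3) *: y) x).
Proof.
rewrite !mul_col_mx !mul_row_col !mul0mx !addr0 add0r mulNmx !mul1mx.
by rewrite mul_scalar_mx.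
Qed.

End Operators.

Arguments opF {R} M N.
Arguments opB {R} M N.

(* Main.v *)
Require Import Defs.
From mathcomp Require Import all_boot all_order all_algebra.
From mathcomp Require Import reals mxtens.
Import GRing.Theory.
Local Open Scope ring_scope.

(** Why the composite is diagonal.

    Write [G(A) := A^T *m A] for the Gram matrix of [A].  Stacking matrices
    vertically adds their Gram matrices, so [G(opB)] is the block-diagonal
    matrix with scalar blocks 2 and [c ^+ 2], where [c = sqrt 3 / 3].  Since
    scalar blocks commute with everything, multiplying by [opF^T] and [opF]
    yields the block-diagonal matrix with blocks 2 times the identity and
    [c ^+ 2 *: G(Ftilde)] ([composite_block]).

    It remains to see that [G(Ftilde)] is diagonal.  It is the sum of the two
    Gram matrices of [stack3 Cminus] and [stack3 Cplus].  By the mixed-product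
    rule, the Gram matrix of a Kronecker product is the Kronecker product of
    the Gram matrices ([gram_tensmx]), and diagonal matrices are closed under
    Kronecker products ([is_diag_tensmx]); so everything reduces to the Gram
    matrices of [Cminus] and [Cplus], which are Diag(I, 0) and Diag(0, I).
    Conceptually, each row of [Cminus] or [Cplus] samples a single node of the
    centred grid, so distinct columns never meet. *)

Lemma is_diag_mxD (V : nmodType) (m n : nat) (A B : 'M[V]_(m, n)) :
  is_diag_mx A -> is_diag_mx B -> is_diag_mx (A + B).
Proof.
move=> /is_diag_mxP dA /is_diag_mxP dB; apply/is_diag_mxP => i j neq_ij.
by rewrite mxE dA // dB // addr0.
Qed.

Lemma is_diag_mxZ (R : pzRingType) (m n : nat) (a : R) (A : 'M[R]_(m, n)) :
  is_diag_mx A -> is_diag_mx (a *: A).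
Proof.
move=> /is_diag_mxP dA; apply/is_diag_mxP => i j neq_ij.
by rewrite mxE dA // mulr0.
Qed.

(** Two distinct pairs of indices differ in one of their components, and the
    corresponding factor of the entry vanishes. *)
Lemma is_diag_tensmx (R : pzRingType) (m n : nat) (A : 'M[R]_m) (B : 'M[R]_n) :
  is_diag_mx A -> is_diag_mx B -> is_diag_mx (tensmx A B).
Proof.
move=> /is_diag_mxP dA /is_diag_mxP dB; apply/is_diag_mxP => i j.
case: (mxtens_indexP i) => i0 i1; case: (mxtens_indexP j) => j0 j1 neq_ij.
rewrite tensmxE; have [eq0|neq0] := eqVneq i0 j0; last by rewrite dA ?mul0r.
have [eq1|neq1] := eqVneq i1 j1; last by rewrite dB ?mulr0.
by rewrite eq0 eq1 eqxx in neq_ij.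
Qed.

Section Gram.
Variable R : comPzRingType.

Lemma gram_tensmx (m n p q : nat) (A : 'M[R]_(m, n)) (B : 'M[R]_(p, q)) :
  (tensmx A B)^T *m tensmx A B = tensmx (A^T *m A) (B^T *m B).
Proof. by rewrite trmx_tens tensmx_mul. Qed.

Lemma gram_col_mx (m1 m2 n : nat) (A : 'M[R]_(m1, n)) (B : 'M[R]_(m2, n)) :
  (col_mx A B)^T *m col_mx A B = A^T *m A + B^T *m B.
Proof. by rewrite tr_col_mx mul_row_col. Qed.

Lemma gram_row_mx (m n1 n2 : nat) (A : 'M[R]_(m, n1)) (B : 'M[R]_(m, n2)) :
  (row_mx A B)^T *m row_mx A B =
    block_mx (A^T *m A) (A^T *m B) (B^T *m A) (B^T *m B).
Proof. by rewrite tr_row_mx mul_col_row. Qed.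

Lemma is_diag_gram_castmx (m n n' : nat) (e : n = n') (A : 'M[R]_(m, n)) :
  is_diag_mx ((castmx (erefl, e) A)^T *m castmx (erefl, e) A) =
    is_diag_mx (A^T *m A).
Proof. by case: _ / e. Qed.

End Gram.

Section Composite.
Variables (R : realType) (M : mesh R) (N : nat).

Lemma is_diag_gram_Cminus : is_diag_mx ((Cminus R N)^T *m Cminus R N).
Proof.
rewrite is_diag_gram_castmx gram_row_mx is_diag_block_mx //.
by rewrite !trmx0 !mulmx0 !mul0mx !eqxx trmx1 mulmx1 scalar_mx_is_diag
  mx0_is_diag.
Qed.

Lemma is_diag_gram_Cplus : is_diag_mx ((Cplus R N)^T *m Cplus R N).
Proof.
(* The explicit sizes read the column count N.+1 as 1 + N. *)
rewrite (@gram_row_mx R N 1 N 0 1%:M).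
rewrite (@is_diag_block_mx _ 1 N 1 N) //.
by rewrite !trmx0 !mulmx0 !mul0mx !eqxx trmx1 mulmx1 scalar_mx_is_diag
  mx0_is_diag.
Qed.

(** The leading factor [1_3] contributes a 1 x 1 Gram matrix, and 1 x 1
    matrices are diagonal: repeating a row does not affect orthogonality of
    the columns. *)
Lemma is_diag_gram_stack3 (C : 'M[R]_(N, N.+1)) :
  is_diag_mx (C^T *m C) -> is_diag_mx ((stack3 M C)^T *m stack3 M C).
Proof.
move=> dC; rewrite is_diag_gram_castmx !gram_tensmx.
apply: is_diag_tensmx; first exact: mx11_is_diag.
by apply: is_diag_tensmx; rewrite // trmx1 mulmx1 scalar_mx_is_diag.
Qed.

Lemma is_diag_gram_Ftilde : is_diag_mx ((Ftilde M N)^T *m Ftilde M N).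
Proof.
rewrite gram_col_mx; apply: is_diag_mxD; apply: is_diag_gram_stack3.
  exact: is_diag_gram_Cminus.
exact: is_diag_gram_Cplus.
Qed.

(** The 2 counts the copies of [x] in [(- x; c y; x)], whose signs square
    away. *)
Lemma gram_opB :
  (opB M N)^T *m opB M N =
    block_mx 2%:M 0 0 ((Num.sqrt 3 / 3) ^+ 2)%:M.
Proof.
rewrite !gram_col_mx !gram_row_mx !trmx0 [(- _)^T]linearN /= !trmx1.
rewrite tr_scalar_mx !mulmx0 !mul0mx mulNmx mulmxN opprK !mulmx1 -scalar_mxM.
by rewrite !add_block_mx !addr0 !add0r -raddfD /= expr2.
Qed.

Lemma composite_block :
  (opF M N)^T *m (opB M N)^T *m opB M N *m opF M N =
    block_mx 2%:M 0 0
      ((Num.sqrt 3 / 3) ^+ 2 *: ((Ftilde M N)^T *m Ftilde M N)).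
Proof.
rewrite -(mulmxA (opF M N)^T) gram_opB tr_block_mx !trmx0 trmx1 !mulmx_block.
rewrite !mul0mx !mulmx0 !mul1mx !mulmx1 !addr0 !add0r !mul0mx.
by rewrite mul_mx_scalar -scalemxAl.
Qed.

End Composite.

Theorem proposition4p3 (R : realType) (M : mesh R) (N : nat) (hN : (1 <= N)%N) :
  is_diag_mx ((opF M N)^T *m (opB M N)^T *m opB M N *m opF M N).
Proof.
rewrite composite_block is_diag_block_mx // !eqxx scalar_mx_is_diag /=.
by apply: is_diag_mxZ; exact: is_diag_gram_Ftilde.
Qed.
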